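(* Let $K$ be a commutative ring with unity, $v,w:\mathbb Z\to K$, $\alpha,\beta\in\mathbb Z$, $s\in\mathbb N=\{0,1,2,\ldots\}$, and $r\ge 0$ an integer. With the $\mathcal V$-Stirling numbers as defined in the context, and all matrices below of size $(r+1)\times(r+1)$ with row index $i$ and column index $j$ ranging over $0\le i,j\le r$, we have the matrix identities $$\Big(c^{\mathcal V}_{\alpha-i,\beta-j}[s+i+j,s+j]\Big)=\Big(c^{\mathcal V}_{\alpha-i,\beta}[s+i,s+j]\Big)\Big(c^{\mathcal V}_{\alpha+s,\beta-j}[j,j-i]\Big),$$ $$\Big(S^{\mathcal V}_{\alpha,\beta-j}[s+i+j,s+j]\Big)=\Big(S^{\mathcal V}_{\alpha,\beta-j}[s+i,s+j]\Big)\Big(S^{\mathcal V}_{\alpha+s+i,\beta-j}[j,j-i]\Big).$$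
   Context: Let $K$ be a commutative ring with unity and $v,w:\mathbb Z\to K$ functions; write $v_i=v(i)$, $w_i=w(i)$ and $\mathcal V=(v,w)$. For finitely many variables, $e_t$ denotes the $t$-th elementary symmetric function and $h_t$ the $t$-th complete homogeneous symmetric function, with $e_0=h_0=1$ and $e_t=h_t=0$ for $t<0$ (and $e_t=0$ when $t$ exceeds the number of variables). For $\alpha,\beta\in\mathbb Z$ and integers $n,k\ge 0$ define $$c^{\mathcal V}_{\alpha,\beta}[n,k]=e_{n-k}\big(v_{\alpha+n-1}w_{\beta},v_{\alpha+n-2}w_{\beta+1},\ldots,v_{\alpha}w_{\beta+n-1}\big)$$ (the $n$ arguments $v_{\alpha+n-1-i}w_{\beta+i}$, $0\le i\le n-1$), and $$S^{\mathcal V}_{\alpha,\beta}[n,k]=h_{n-k}\big(v_{\alpha+k}w_{\beta},v_{\alpha+k-1}w_{\beta+1},\ldots,v_{\alpha}w_{\beta+k}\big)$$ (the $k+1$ arguments $v_{\alpha+k-i}w_{\beta+i}$, $0\le i\le k$). In particular both vanish when $k>n$. If $n<0$ or $k<0$, both are defined to be $0$. *)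

(* Defs.v *)
From mathcomp Require Import all_boot all_order all_algebra.

Set Implicit Arguments.
Unset Strict Implicit.
Unset Printing Implicit Defensive.

Import GRing.Theory.
Local Open Scope ring_scope.

Section StirlingNumbers.

Variable K : comPzRingType.

(* The degree is an [int], so that negative degrees are allowed (value 0). The
   sum is empty, hence 0, when t exceeds m. *)
Definition esym (m : nat) (x : 'I_m -> K) (t : int) : K :=
  match t with
  | Posz t => \sum_(A : {set 'I_m} | #|A| == t) \prod_(i in A) x i
  | Negz _ => 0
  end.

(* Sum over the exponent vectors f of all monomials of total degree t; each
   exponent is at most t, which makes the set of such vectors finite. *)
Definition hsym (m : nat) (x : 'I_m -> K) (t : int) : K :=
  match t with
  | Posz t =>
      \sum_(f : {ffun 'I_m -> 'I_t.+1} | (\sum_i f i)%N == t)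
        \prod_i x i ^+ f i
  | Negz _ => 0
  end.

Variables v w : int -> K.

Definition stirling_c (a b n k : int) : K :=
  match n, k with
  | Posz n, Posz k =>
      esym (fun i : 'I_n => v (a + n%:Z - 1 - i%:Z) * w (b + i%:Z))
           (n%:Z - k%:Z)
  | _, _ => 0
  end.

Definition stirling_S (a b n k : int) : K :=
  match n, k with
  | Posz n, Posz k =>
      hsym (fun i : 'I_k.+1 => v (a + k%:Z - i%:Z) * w (b + i%:Z))
           (n%:Z - k%:Z)
  | _, _ => 0
  end.

End StirlingNumbers.

(* Main.v *)
Require Import Defs.
From mathcomp Require Import all_boot all_order all_algebra.
From mathcomp Require Import zify.

Set Implicit Arguments.
Unset Strict Implicit.
Unset Printing Implicit Defensive.

Import GRing.Theory.
Local Open Scope ring_scope.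

(** The entries of the left-hand matrices are e_i or h_i of a sequence
x_0, ..., x_(N-1) with x_m = v_(a' - m) w_(b' + m).  For c, the right-hand side
is the expansion of e_i over the splitting of the sequence into its first j and
its remaining terms.  For S, a monomial of h_i in N variables is a lattice path
with i north and N - 1 east steps, a north step in column m having weight x_m;
cutting the path after its first j steps, k of which are north, cuts it in
column j - k, whence
h_i(x_0, ..., x_(N-1)) = sum_k h_k(x_0, ..., x_(j-k)) h_(i-k)(x_(j-k), ..., x_(N-1)). *)

Section SymmetricFunctions.

Variable K : comPzRingType.

(** A common form of e and h: [T] with [g] lists the allowed exponents, [bool] for e and ['I_t.+1]
    for h, so that removing a variable is treated once. *)
Definition weight_sum (T : finType) (g : T -> nat) (m : nat) (x : 'I_m -> K)
    (t : nat) : K :=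
  \sum_(f : {ffun 'I_m -> T} | (\sum_i g (f i))%N == t)
    \prod_i x i ^+ g (f i).

Lemma weight_sum0 (T : finType) (g : T -> nat) (x : 'I_0 -> K) t :
  weight_sum g x t = (t == 0)%:R.
Proof.
have f0 : {ffun 'I_0 -> T} by apply: ffun0; rewrite card_ord.
rewrite /weight_sum (eq_bigl (fun f => (f == f0) && (t == 0))) => [|f]; last first.
  have -> : f = f0 by apply/ffunP => -[].
  by rewrite big_ord0 eq_sym eqxx.
case: (t == 0); last by rewrite big1 // => f; rewrite andbF.
by rewrite (big_pred1 f0) => [|f]; rewrite ?big_ord0 ?andbT.
Qed.

(** Monomials are sorted by the choice [c] at [x ord0]; [glue] is the bijection joining it to the
    choices on the other variables. *)
Lemma weight_sumS (T : finType) (g : T -> nat) m (x : 'I_m.+1 -> K) t :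
  weight_sum g x t = \sum_(c | (g c <= t)%N)
    x ord0 ^+ g c * weight_sum g (fun i => x (lift ord0 i)) (t - g c).
Proof.
pose glue (p : T * {ffun 'I_m -> T}) : {ffun 'I_m.+1 -> T} :=
  [ffun i => if unlift ord0 i is Some j then p.2 j else p.1].
have glue0 p : glue p ord0 = p.1 by rewrite ffunE unlift_none.
have glueS p i : glue p (lift ord0 i) = p.2 i by rewrite ffunE liftK.
rewrite /weight_sum (reindex glue) /=; last first.
  exists (fun f => (f ord0, [ffun i => f (lift ord0 i)])) => [[c f]|f] _.
    by congr pair; rewrite ?glue0 //; apply/ffunP => i; rewrite ffunE glueS.
  apply/ffunP => i; case: (unliftP ord0 i) => [j|] ->.
    by rewrite glueS ffunE.
  by rewrite glue0.
under [RHS]eq_bigr do rewrite mulr_sumr.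
rewrite pair_big_dep; apply: eq_big => -[c f] /=; last first.
  move=> _; rewrite big_ord_recl glue0 /=; congr (_ * _).
  by apply: eq_bigr => i _; rewrite glueS.
rewrite big_ord_recl glue0 /=; under eq_bigr do rewrite glueS /=.
lia.
Qed.

Lemma eq_weight_sum (T : finType) (g : T -> nat) m (x y : 'I_m -> K) t :
  x =1 y -> weight_sum g x t = weight_sum g y t.
Proof.
by move=> xy; apply: eq_bigr => f _; apply: eq_bigr => i _; rewrite xy.
Qed.

(** No exponent exceeds the total degree. Removing a variable lowers the degree but keeps the
    exponent type, which this lemma readjusts. *)
Lemma weight_sum_ord_bound m (x : 'I_m -> K) n t : (t < n)%N ->
  weight_sum (@nat_of_ord n) x t = weight_sum (@nat_of_ord t.+1) x t.
Proof.
elim: m x n t => [|m IH] x n t ltn; first by rewrite !weight_sum0.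
rewrite !weight_sumS.
pose F l := x ord0 ^+ l *
  weight_sum (@nat_of_ord (t - l).+1) (fun i => x (lift ord0 i)) (t - l).
have narrow p : (t < p)%N -> \sum_(c < p | (c <= t)%N) x ord0 ^+ c *
    weight_sum (@nat_of_ord p) (fun i => x (lift ord0 i)) (t - c)
    = \sum_(c < t.+1) F c.
  move=> ltp; rewrite (big_ord_widen p F) //.
  by apply: eq_bigr => c lec; rewrite IH //; lia.
by rewrite !narrow.
Qed.

Lemma esym_weight_sum m (x : 'I_m -> K) (t : nat) :
  Defs.esym x t = weight_sum nat_of_bool x t.
Proof.
rewrite /Defs.esym /weight_sum (reindex (fun f : {ffun 'I_m -> bool} => [set i | f i])).
  apply: eq_big => [f|f _].
    rewrite -sum1_card big_mkcond /=; congr (_ == _).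
    by apply: eq_bigr => i _; rewrite inE; case: (f i).
  rewrite big_mkcond; apply: eq_bigr => i _; rewrite inE.
  by case: (f i); rewrite ?expr1 ?expr0.
exists (fun A : {set 'I_m} => [ffun i => i \in A]) => [f|A] _.
  by apply/ffunP => i; rewrite ffunE inE.
by apply/setP => i; rewrite inE ffunE.
Qed.

Lemma hsym_weight_sum m (x : 'I_m -> K) (t : nat) :
  hsym x t = weight_sum (@nat_of_ord t.+1) x t.
Proof. by []. Qed.

(** Variables come from a sequence on [nat], so that shifting and cutting it needs no casts between
    ordinals. *)
Definition esymn (m : nat) (x : nat -> K) (t : nat) : K :=
  Defs.esym (fun i : 'I_m => x i) t.

Definition hsymn (m : nat) (x : nat -> K) (t : nat) : K :=
  hsym (fun i : 'I_m => x i) t.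

Lemma eq_esymn m (x y : nat -> K) t :
  (forall i, (i < m)%N -> x i = y i) -> esymn m x t = esymn m y t.
Proof.
by move=> xy; rewrite /esymn !esym_weight_sum; apply: eq_weight_sum => i; apply: xy.
Qed.

Lemma eq_hsymn m (x y : nat -> K) t :
  (forall i, (i < m)%N -> x i = y i) -> hsymn m x t = hsymn m y t.
Proof. by move=> xy; apply: eq_weight_sum => i; apply: xy. Qed.

Lemma esymn0l (x : nat -> K) t : esymn 0 x t = (t == 0)%:R.
Proof. by rewrite /esymn esym_weight_sum weight_sum0. Qed.

Lemma hsymn0l (x : nat -> K) t : hsymn 0 x t = (t == 0)%:R.
Proof. by rewrite /hsymn hsym_weight_sum weight_sum0. Qed.

Lemma esymnS m (x : nat -> K) t :
  esymn m.+1 x t = esymn m (fun i => x i.+1) t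
    + (if t is t'.+1 then x 0%N * esymn m (fun i => x i.+1) t' else 0).
Proof.
rewrite /esymn esym_weight_sum weight_sumS big_mkcond big_bool /= addrC.
have tailE u : weight_sum nat_of_bool (fun i : 'I_m => x (lift ord0 i)) u
    = Defs.esym (fun i : 'I_m => x i.+1) u.
  by rewrite esym_weight_sum; apply: eq_weight_sum.
rewrite expr0 mul1r subn0 tailE; congr (_ + _).
by case: t => [|t] //=; rewrite expr1 subn1 tailE.
Qed.

Lemma hsymn_expand m (x : nat -> K) t :
  hsymn m.+1 x t
  = \sum_(l < t.+1) x 0%N ^+ l * hsymn m (fun i => x i.+1) (t - l).
Proof.
rewrite /hsymn hsym_weight_sum weight_sumS.
apply: eq_big => [l|l _]; first by rewrite -ltnS ltn_ord.
by rewrite weight_sum_ord_bound ?ltnS ?leq_subr.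
Qed.

(** In the expansion, [l = 0] collects the monomials without [x 0]; dividing the others by [x 0]
    leaves degree [t]. *)
Lemma hsymnS m (x : nat -> K) t :
  hsymn m.+1 x t.+1
  = hsymn m (fun i => x i.+1) t.+1 + x 0%N * hsymn m.+1 x t.
Proof.
rewrite !hsymn_expand big_ord_recl expr0 mul1r subn0 mulr_sumr; congr (_ + _).
by apply: eq_bigr => l _; rewrite /= exprS mulrA.
Qed.

Lemma hsymn0r m (x : nat -> K) : hsymn m x 0 = 1.
Proof.
elim: m x => [|m IH] x; first by rewrite hsymn0l.
by rewrite hsymn_expand big_ord_recl big_ord0 IH expr0 mulr1 addr0.
Qed.

Lemma esymn_gt m (x : nat -> K) t : (m < t)%N -> esymn m x t = 0.
Proof.
elim: m x t => [|m IH] x [|t] // ltmt; first by rewrite esymn0l.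
by rewrite esymnS !IH ?mulr0 ?addr0 // ltnW.
Qed.

Lemma esymn_split m n (x : nat -> K) t :
  esymn (m + n) x t
  = \sum_(k < t.+1) esymn m x k * esymn n (fun i => x (m + i)%N) (t - k).
Proof.
elim: m x t => [|m IH] x t.
  rewrite big_ord_recl esymn0l mul1r subn0 big1 ?addr0 // => k _.
  by rewrite esymn0l mul0r.
rewrite addSn esymnS IH.
under [RHS]eq_bigr do rewrite esymnS mulrDl.
rewrite big_split /=; congr (_ + _).
(* In the part divisible by [x 0] the term [k = 0] is zero, and the other indices shift by one. *)
case: t => [|t]; first by rewrite big_ord_recl big_ord0 /= mul0r addr0.
rewrite big_ord_recl /= mul0r add0r IH mulr_sumr.
by apply: eq_bigr => k _; rewrite mulrA.
Qed.

(* The truncated subtractions do no harm: for k > j the first factor is h_k of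
   no variables, hence 0. *)
Lemma hsymn_split j n (x : nat -> K) t : (j < n)%N ->
  hsymn n x t = \sum_(k < t.+1) hsymn (j.+1 - k) x k
    * hsymn (n - (j - k)) (fun i => x (j - k + i)%N) (t - k).
Proof.
elim: j n x t => [|j IH] n x t ltjn.
  rewrite big_ord_recl hsymn0r mul1r !subn0 big1 ?addr0 // => k _.
  by rewrite subSS sub0n hsymn0l mul0r.
case: n ltjn => // n ltjn.
case: t => [|t]; first by rewrite big_ord_recl big_ord0 !hsymn0r mul1r addr0.
(* First step of the path: east drops column 0, north costs [x 0] and lowers the degree. Either
   remainder is cut after [j] further steps. *)
rewrite hsymnS (IH n) // (IH n.+1 x t) 1?ltnW //.
rewrite mulr_sumr big_ord_recl [RHS]big_ord_recl !hsymn0r !mul1r -addrA.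
congr (_ + _); first by rewrite !subn0.
rewrite -big_split; apply: eq_bigr => k _ /=.
rewrite /bump /= add1n !subSS.
have -> : hsymn (j.+1 - k) x k.+1
    = hsymn (j - k) (fun i => x i.+1) k.+1 + x 0%N * hsymn (j.+1 - k) x k.
  case: (leqP k j) => [lekj|ltjk]; first by rewrite subSn // hsymnS.
  have [-> ->] : (j.+1 - k = 0 /\ j - k = 0)%N by lia.
  by rewrite !hsymn0l (gtn_eqF (leq_ltn_trans (leq0n j) ltjk)) mulr0 addr0.
rewrite mulrDl mulrA; congr (_ + _).
(* For [k < j] the cut columns agree. For [k >= j] truncation makes them differ, but the common
   factor has positive degree in no variables. *)
case: (ltnP k j) => [ltkj|lejk]; last first.
  by rewrite (eqP lejk) hsymn0l !mul0r.
congr (_ * _).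
have -> : (n.+1 - (j - k) = n - (j - k.+1))%N by lia.
by apply: eq_hsymn => i _; congr x; lia.
Qed.

(** The second index is expressed through the degree [t]. It is negative for [t > n], where its
    default value 0 agrees with e_t of too few variables; this covers the entries [[j, j - i]] with
    [i > j]. *)
Lemma stirling_cE (v w : int -> K) (a b : int) (n t : nat) :
  stirling_c v w a b n (n%:Z - t%:Z)
  = esymn n (fun i => v (a + n%:Z - 1 - i%:Z) * w (b + i%:Z)) t.
Proof.
case: (leqP t n) => [letn|ltnt].
  by rewrite subzn //= -subzn // subKr.
rewrite esymn_gt // /stirling_c.
by case E: (n%:Z - t%:Z) => [k|k] //; lia.
Qed.

Lemma stirling_SE (v w : int -> K) (a b : int) (n t : nat) :
  stirling_S v w a b n (n%:Z - t%:Z)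
  = hsymn (n.+1 - t)
      (fun i => v (a + n%:Z - t%:Z - i%:Z) * w (b + i%:Z)) t.
Proof.
case: (leqP t n) => [letn|ltnt].
  rewrite subSn // subzn //= -subzn // subKr.
  by apply: eq_weight_sum => i; rewrite addrA.
have -> : (n.+1 - t = 0)%N by lia.
rewrite hsymn0l gtn_eqF; last by lia.
by rewrite /stirling_S; case E: (n%:Z - t%:Z) => [k|k] //; lia.
Qed.

Lemma stirling_c_gt (v w : int -> K) (a b n k : int) :
  (n < k)%R -> stirling_c v w a b n k = 0.
Proof.
rewrite /stirling_c; case: n k => [n|n] [k|k] // ltnk.
by case E: (n%:Z - k%:Z) => [t|t] //; lia.
Qed.

Lemma stirling_S_gt (v w : int -> K) (a b n k : int) :
  (n < k)%R -> stirling_S v w a b n k = 0.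
Proof.
rewrite /stirling_S; case: n k => [n|n] [k|k] // ltnk.
by case E: (n%:Z - k%:Z) => [t|t] //; lia.
Qed.

End SymmetricFunctions.

Theorem theorem6p2 (K : comPzRingType) (v w : int -> K) (a b : int)
    (s r : nat) :
  \matrix_(i < r.+1, j < r.+1)
      stirling_c v w (a - i%:Z) (b - j%:Z) (s%:Z + i%:Z + j%:Z) (s%:Z + j%:Z)
  = (\matrix_(i < r.+1, j < r.+1)
       stirling_c v w (a - i%:Z) b (s%:Z + i%:Z) (s%:Z + j%:Z))
    *m (\matrix_(i < r.+1, j < r.+1)
       stirling_c v w (a + s%:Z) (b - j%:Z) j%:Z (j%:Z - i%:Z))
  /\
  \matrix_(i < r.+1, j < r.+1)
      stirling_S v w a (b - j%:Z) (s%:Z + i%:Z + j%:Z) (s%:Z + j%:Z)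
  = (\matrix_(i < r.+1, j < r.+1)
       stirling_S v w a (b - j%:Z) (s%:Z + i%:Z) (s%:Z + j%:Z))
    *m (\matrix_(i < r.+1, j < r.+1)
       stirling_S v w (a + s%:Z + i%:Z) (b - j%:Z) j%:Z (j%:Z - i%:Z)).
Proof.
split; apply/matrixP => i j; rewrite !mxE.
  under eq_bigr do rewrite !mxE.
  have -> : s%:Z + i%:Z + j%:Z = (j + (s + i))%N by lia.
  have -> : s%:Z + j%:Z = (j + (s + i))%N%:Z - i%:Z by lia.
  rewrite stirling_cE esymn_split.
  (* The sum over [k <= i] is extended to the range [k <= r] of the matrix product; the left factor
     vanishes for [k > i]. *)
  rewrite (big_ord_widen r.+1 (fun k : nat => esymn j _ k * esymn (s + i) _ (i - k)))
    // big_mkcond.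
  apply: eq_bigr => k _; case: ifPn => [|leik]; last first.
    by rewrite stirling_c_gt ?mul0r //; lia.
  (* The first [j] variables give the right matrix and the last [s + i] the left one. *)
  rewrite ltnS => leki; rewrite mulrC.
  have -> : s%:Z + k%:Z = (s + i)%N%:Z - (i - k)%N%:Z by lia.
  rewrite -PoszD !stirling_cE; congr (_ * _); apply: eq_esymn => m _.
    by congr (v _ * w _); lia.
  by congr (v _ * w _); lia.
under eq_bigr do rewrite !mxE.
have -> : s%:Z + i%:Z + j%:Z = (s + i + j)%N by lia.
have -> : s%:Z + j%:Z = (s + i + j)%N%:Z - i%:Z by lia.
rewrite stirling_SE; set x := (x in hsymn _ x _).
(* There are [s + j + 1] variables. For [k <= j] the piece from column [j - k] starts at
   [v (a + s + k) * w (b - k)], as in the left matrix. *)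
rewrite (@hsymn_split _ j); last by lia.
rewrite (big_ord_widen r.+1 (fun k : nat => hsymn (j.+1 - k) x k
    * hsymn ((s + i + j).+1 - i - (j - k)) (fun m => x (j - k + m)%N) (i - k)))
  // big_mkcond.
apply: eq_bigr => k _; case: ifPn => [|leik]; last first.
  by rewrite stirling_S_gt ?mul0r //; lia.
rewrite ltnS => leki; rewrite mulrC.
have -> : s%:Z + k%:Z = (s + i)%N%:Z - (i - k)%N%:Z by lia.
rewrite -PoszD !stirling_SE.
(* For [k > j] the numbers of variables in the other factors disagree, but both products contain h_k
   of no variables. *)
case: (leqP k j) => [lekj|ltjk]; last first.
  have -> : (j.+1 - k = 0)%N by lia.
  by rewrite !hsymn0l gtn_eqF ?mulr0 //; lia.
have -> : ((s + i + j).+1 - i - (j - k) = (s + i).+1 - (i - k))%N by lia.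
congr (_ * _); apply: eq_hsymn => m _; first by congr (v _ * w _); lia.
by congr (v _ * w _); lia.
Qed.
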